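(* Let $F$ be a scalar group and let $V$ be a near-vector space over $F$. Let $S,T$ be finite subsets of $Q(V)$, where $S$ is linearly independent and $\operatorname{Span}(S)\subseteq\operatorname{Span}(T)$. Then $|S|\le|T|$ and there exists $T_0\subseteq T$, disjoint from $S$, such that $\operatorname{Span}(S\cup T_0)=\operatorname{Span}(T)$.
   Context: A scalar group is a tuple $F=(F,\cdot,1,0,-1)$ where $(F,\cdot,1)$ is a monoid, $0,-1\in F$, $0\cdot\alpha=0=\alpha\cdot 0$ for all $\alpha\in F$, $\{1,-1\}$ is the solution set of the equation $x^2=1$ in $F$, and $(F\setminus\{0\},\cdot,1)$ is a group. An $F$-space is an abelian group $(V,+)$ with a map $F\times V\to V$, $(\alpha,v)\mapsto\alpha\cdot v$, such that for all $\alpha,\beta\in F$, $v,w\in V$: $\alpha\cdot(\beta\cdot v)=(\alpha\cdot\beta)\cdot v$, $1\cdot v=v$, $\alpha\cdot(v+w)=\alpha\cdot v+\alpha\cdot w$, $(-1)\cdot v=-v$, $0\cdot v=0$. The quasi-kernel of $V$ is $Q(V)=\{v\in V\mid \forall \alpha,\beta\in F\ \exists\gamma\in F:\ \alpha\cdot v+\beta\cdot v=\gamma\cdot v\}$. A near-vector space over $F$ is an $F$-space $V$ whose action is free (if $\alpha\cdot v=\beta\cdot v$ then $v=0$ or $\alpha=\beta$) and such that $Q(V)$ generates $V$ as an additive group. $\operatorname{Span}(S)$ is the intersection of all nonempty subsets of $V$ that contain $S$ and are closed under addition and scalar multiplication. A subset $S\subseteq V$ is linearly independent if $0\notin S$ and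 for any nonempty finite $A\subseteq S$, $n_a\in\mathbb N$ and $\alpha_{a,i}\in F$ ($a\in A$, $1\le i\le n_a$), if $\sum_{a\in A}\left(\sum_{i=1}^{n_a}\alpha_{a,i}\cdot a\right)=0$ then $\sum_{i=1}^{n_a}\alpha_{a,i}\cdot a=0$ for all $a\in A$. *)

(* Defs.v *)
From HB Require Import structures.
From mathcomp Require Import all_boot all_order all_algebra finmap.
From mathcomp Require Import boolp classical_sets.

Set Implicit Arguments.
Unset Strict Implicit.
Unset Printing Implicit Defensive.

Import GRing.Theory.

Local Open Scope classical_set_scope.
Local Open Scope ring_scope.

Reserved Notation "a **: v" (at level 40, left associativity).

(* The last three axioms, with the monoid laws, say that F \ {0} is a group
   under the multiplication of F: it contains 1, is closed under products and
   has two-sided inverses. The elements 1 and sgm1 need not be distinct. *)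
HB.mixin Record Monoid_isScalarGroup F of monoid.Monoid F := {
  sg0 : F;
  sgm1 : F;
  sgmul0 : forall a : F, (sg0 * a)%g = sg0;
  sgmulr0 : forall a : F, (a * sg0)%g = sg0;
  sgsqr1 : forall a : F, (a * a)%g = 1%g <-> a = 1%g \/ a = sgm1;
  sgone_neq0 : 1%g <> sg0 :> F;
  sgmul_neq0 : forall a b : F, a <> sg0 -> b <> sg0 -> (a * b)%g <> sg0;
  sginv : forall a : F, a <> sg0 ->
    exists b : F, [/\ b <> sg0, (a * b)%g = 1%g & (b * a)%g = 1%g]
}.

#[short(type="scalarGroupType")]
HB.structure Definition ScalarGroup :=
  {F of Monoid_isScalarGroup F & monoid.Monoid F}.

HB.mixin Record Zmodule_isFSpace (F : scalarGroupType) V of GRing.Zmodule V := {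
  fscale : F -> V -> V;
  fscaleA : forall (a b : F) (v : V), fscale a (fscale b v) = fscale (a * b)%g v;
  fscale1 : forall v : V, fscale 1%g v = v;
  fscaleDr : forall (a : F) (v w : V),
    fscale a (v + w) = fscale a v + fscale a w;
  fscaleN1 : forall v : V, fscale sgm1 v = - v;
  fscale0 : forall v : V, fscale sg0 v = 0
}.

#[short(type="fspaceType")]
HB.structure Definition FSpace (F : scalarGroupType) :=
  {V of Zmodule_isFSpace F V & GRing.Zmodule V}.

Notation "a **: v" := (fscale a v) : ring_scope.

Definition quasi_kernel (F : scalarGroupType) (V : fspaceType F) : set V :=
  [set v | forall a b : F, exists c : F, a **: v + b **: v = c **: v].

Definition additive_subgroup (V : zmodType) (W : set V) : Prop :=
  W 0 /\ forall v w, W v -> W w -> W (v - w).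

HB.mixin Record FSpace_isNearVect (F : scalarGroupType) V of FSpace F V := {
  fscale_free : forall (a b : F) (v : V), a **: v = b **: v -> v = 0 \/ a = b;
  quasi_kernel_gen : smallest (@additive_subgroup V) (@quasi_kernel F V) = setT
}.

#[short(type="nearVectType")]
HB.structure Definition NearVect (F : scalarGroupType) :=
  {V of FSpace_isNearVect F V & FSpace F V}.

Definition fsubspace (F : scalarGroupType) (V : fspaceType F) (W : set V) : Prop :=
  [/\ W !=set0,
      forall v w, W v -> W w -> W (v + w) &
      forall (a : F) v, W v -> W (a **: v)].

Definition Span (F : scalarGroupType) (V : fspaceType F) (S : set V) : set V :=
  smallest (@fsubspace F V) S.

Definition lin_indep (F : scalarGroupType) (V : fspaceType F) (S : set V) : Prop :=
  ~ S 0 /\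
  forall (A : {fset V}) (n : V -> nat) (alpha : V -> nat -> F),
    A != fset0 -> [set` A] `<=` S ->
    \sum_(a <- A) \sum_(1 <= i < (n a).+1) alpha a i **: a = 0 ->
    forall a, a \in A -> \sum_(1 <= i < (n a).+1) alpha a i **: a = 0.

(* Main.v *)
Require Import Defs.
From mathcomp Require Import all_boot all_order all_algebra finmap.
From mathcomp Require Import boolp classical_sets.

(** Every element of the span of A `|` [set t] with t in the quasi-kernel has
    the form a + c **: t with a in the span of A.  If c is nonzero one can solve
    for t, so spans have the exchange property with respect to elements of the
    quasi-kernel, and the classical Steinitz argument goes through: the elements
    of S are inserted one at a time, each replacing an element of T. *)

Local Open Scope classical_set_scope.

Section Span.
Set Implicit Arguments.
Unset Strict Implicit.
Import GRing.Theory.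
Local Open Scope ring_scope.

Context {F : scalarGroupType} {V : fspaceType F}.
Implicit Types (a c : F) (A B W : set V) (S T : {fset V}) (s t v w : V).

Lemma fscale_r0 a : a **: (0 : V) = 0.
Proof. by rewrite -(fscale0 (0 : V)) fscaleA sgmulr0. Qed.

Lemma fscale_rN a v : a **: (- v) = - (a **: v).
Proof. by apply/eqP; rewrite -addr_eq0 -fscaleDr addNr fscale_r0. Qed.

Lemma fsubspace_Span A : fsubspace (Span A).
Proof.
split.
- exists 0 => W [[[w Ww] _ WZ] _]; rewrite -(fscale0 w); exact: WZ.
- move=> v w Av Aw W WA; have [[_ WD _] _] := WA.
  by apply: WD; [exact: Av | exact: Aw].
- by move=> a v Av W WA; have [[_ _ WZ] _] := WA; apply: WZ; exact: Av.
Qed.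

Lemma SpanD A v w : Span A v -> Span A w -> Span A (v + w).
Proof. by have [_ + _] := fsubspace_Span A; apply. Qed.

Lemma SpanZ A a v : Span A v -> Span A (a **: v).
Proof. by have [_ _] := fsubspace_Span A; apply. Qed.

Lemma SpanB A v w : Span A v -> Span A w -> Span A (v - w).
Proof. by move=> Av Aw; apply: SpanD => //; rewrite -fscaleN1; exact: SpanZ. Qed.

Lemma Span0 A : Span A 0.
Proof.
by have [[v Av] _ _] := fsubspace_Span A; rewrite -(fscale0 v); exact: SpanZ.
Qed.

Lemma mem_Span A v : A v -> Span A v.
Proof. by move=> Av W [_]; apply. Qed.

Lemma Span_min A W : fsubspace W -> A `<=` W -> Span A `<=` W.
Proof. by move=> sW AW v; apply. Qed.

Lemma Span_subset A B : A `<=` Span B -> Span A `<=` Span B.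
Proof. by apply: Span_min; exact: fsubspace_Span. Qed.

(** The vectors [v] admitting such a [c] form a subspace containing [t] and [A]. Closure under
    addition is where [t] being in the quasi-kernel enters: it merges [c **: t + d **: t] into one
    multiple of [t]. *)
Lemma Span_setU1 A t v : quasi_kernel t -> Span (t |` A) v ->
  exists c, Span A (v - c **: t).
Proof.
move=> tQ; move: v.
change (Span (t |` A) `<=` [set v | exists c, Span A (v - c **: t)]).
apply: Span_min; first split.
- by exists 0, sg0; rewrite fscale0 subr0; exact: Span0.
- move=> v w [c Av] [d Aw]; have [e ce] := tQ c d.
  by exists e; rewrite -ce opprD addrACA; exact: SpanD.
- move=> a v [c Av]; exists (a * c)%g.
  by rewrite -fscaleA -fscale_rN -fscaleDr; exact: SpanZ.
- move=> v [->|Av].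
    by exists 1%g; rewrite fscale1 subrr; exact: Span0.
  by exists sg0; rewrite fscale0 subr0; exact: mem_Span.
Qed.

Lemma Span_setU1_exchange A s t : quasi_kernel t ->
  Span (t |` A) s -> ~ Span A s -> Span (s |` A) t.
Proof.
move=> tQ /(Span_setU1 tQ)[c Asct] nAs.
have [c0|/sginv[b [_ _ bc1]]] := EM (c = sg0).
  by move: Asct; rewrite c0 fscale0 subr0.
have sU : A `<=` Span (s |` A) by move=> v Av; apply: mem_Span; right.
have -> : t = b **: (s - (s - c **: t)).
  by rewrite subKr fscaleA bc1 fscale1.
apply: SpanZ; apply: SpanB; first by apply: mem_Span; left.
exact: (Span_subset sU).
Qed.

(** Induction on [T]: the exchanged vector is the first one whose insertion brings [s] into the
    span. Keeping [A] apart from [T] ensures that vectors of [A] are never the ones given up. *)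
Lemma Span_fset_exchange A T s : [set` T] `<=` quasi_kernel (V := V) ->
    Span (A `|` [set` T]) s -> ~ Span A s ->
  exists2 t, t \in T & Span (s |` (A `|` [set` (T `\ t)%fset])) t.
Proof.
move=> + + nAs; elim/fset1U_rect: T => [|t T tT IH] TQ sT.
  by case: nAs; apply: Span_subset sT => v [/mem_Span|].
have TQ' : [set` T] `<=` quasi_kernel (V := V).
  by move=> v /= vT; apply: TQ; rewrite /= !inE vT orbT.
have [sT'|nsT'] := EM (Span (A `|` [set` T]) s).
  have [u uT tu] := IH TQ' sT'.
  exists u; first by rewrite !inE uT orbT.
  apply: Span_subset tu => v vU; apply: mem_Span; move: vU.
  move=> [->|[Av|/=]]; [by left|by right; left|].
  by rewrite !inE => /andP[vu vT]; right; right; rewrite /= vu vT orbT.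
exists t; first by rewrite !inE eqxx.
rewrite fsetU1K //; apply: Span_setU1_exchange nsT'.
  by apply: TQ; rewrite /= !inE eqxx.
apply: Span_subset sT => v [Av|/=]; first by apply: mem_Span; right; left.
rewrite !inE => /orP[/eqP ->|vT]; apply: mem_Span; first by left.
by right; right.
Qed.

(** One coefficient per vector suffices, since multiples of a quasi-kernel element add up to a
    single multiple. *)
Lemma Span_fset_sum S v : [set` S] `<=` quasi_kernel (V := V) ->
  Span [set` S] v -> exists c : V -> F, v = \sum_(s <- S) c s **: s.
Proof.
elim/fset1U_rect: S v => [|s S sS IH] v SQ Sv.
  have sub0 : fsubspace [set 0 : V].
    by split=> [|x y -> ->|a x ->]; [exists 0|rewrite addr0|rewrite fscale_r0].
  exists (fun=> sg0); rewrite big_seq_fset0.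
  by apply: (Span_min sub0) Sv => w.
have sQ : quasi_kernel s by apply: SQ; rewrite /= !inE eqxx.
have [|d Svd] := @Span_setU1 [set` S] s v sQ.
  apply: Span_subset Sv => w /=; rewrite !inE => wU.
  by apply: mem_Span; case/orP: wU => [/eqP ->|wS]; [left|right].
have SQ' : [set` S] `<=` quasi_kernel (V := V).
  by move=> w /= wS; apply: SQ; rewrite /= !inE wS orbT.
have [c vE] := IH _ SQ' Svd.
(* Overriding [c] at [s] leaves the sum over [S] unchanged, because [s] is not in [S]. *)
exists (fun t => if t == s then d else c t).
rewrite big_fsetU1 //= eqxx -[LHS](subrK (d **: s)) vE addrC; congr (_ + _).
rewrite big_seq [RHS]big_seq; apply: eq_bigr => t tS.
by case: eqP tS sS => // -> ->.
Qed.

(** Moving [s] to the other side of an expression of [s] over [S] gives a vanishing sum whose term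
    at [s] is [- s]; independence forces [s = 0], which is excluded. *)
Lemma lin_indep_notin_Span S s : [set` S] `<=` quasi_kernel (V := V) ->
  lin_indep [set` (s |` S)%fset] -> s \notin S -> ~ Span [set` S] s.
Proof.
move=> SQ [S0 Sfree] sS /(Span_fset_sum SQ)[c sE].
(* The inner sums of [lin_indep] are taken of length one, and [sgm1] produces the term [- s]. *)
pose alpha t (_ : nat) := if t == s then sgm1 : F else c t.
have sum1 t : \sum_(1 <= i < 2) alpha t i **: t = alpha t 1%N **: t.
  by rewrite big_nat1.
have sU : s \in (s |` S)%fset by rewrite !inE eqxx.
suff s0 : - s = 0 by apply: S0; rewrite /= -[0]oppr0 -s0 opprK.
have := Sfree (s |` S)%fset (fun=> 1%N) alpha _ _ _ s sU.
rewrite sum1 /alpha eqxx fscaleN1; apply => //.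
  by apply/fset0Pn; exists s.
rewrite big_fsetU1 //= big_nat1 eqxx fscaleN1 [X in - X + _]sE.
apply/eqP; rewrite addrC subr_eq0; apply/eqP.
rewrite big_seq [RHS]big_seq; apply: eq_bigr => t tS.
by rewrite big_nat1; case: eqP tS sS => // -> ->.
Qed.

Lemma lin_indepS A B : A `<=` B -> lin_indep B -> lin_indep A.
Proof.
move=> AB [B0 Bfree]; split=> [/AB //|C n alpha C0 CA].
by apply: Bfree C0 _; exact: subset_trans AB.
Qed.

(** The bound on [#|] S| + #|[T0|] is the invariant of the induction on [S], which starts from
    [T0 = T]. Here [T0] may meet [S]. *)
Lemma Steinitz_exchange S T :
    [set` S] `<=` quasi_kernel (V := V) -> [set` T] `<=` quasi_kernel (V := V) ->
    lin_indep [set` S] -> [set` S] `<=` Span [set` T] ->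
  exists T0 : {fset V},
    [/\ (T0 `<=` T)%fset, (#|` S| + #|` T0| <= #|` T|)%N &
        Span [set` (S `|` T0)%fset] = Span [set` T]].
Proof.
move=> + TQ; elim/fset1U_rect: S => [|s S sS IH] SQ Sfree ST.
  by exists T; rewrite fset0U cardfs0 add0n leqnn fsubset_refl.
have subS : [set` S] `<=` [set` (s |` S)%fset].
  by move=> v /= vS; rewrite !inE vS orbT.
have SQ' := subset_trans subS SQ.
have [T0 [T0T leT0 T0E]] :=
  IH SQ' (lin_indepS subS Sfree) (subset_trans subS ST).
have sT : Span [set` T] s by apply: ST; rewrite /= !inE eqxx.
(* With [S] as the protected set, the vector traded for [s] comes from [T0]; independence keeps [s]
   out of the span of [S]. *)
have [||t tT0 tE] := @Span_fset_exchange [set` S] T0 s _ _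
  (lin_indep_notin_Span SQ' Sfree sS).
- by move=> v /= /(fsubsetP T0T)/TQ.
- move: sT; rewrite -T0E; apply: Span_subset => v /=.
  by rewrite inE => vU; apply: mem_Span; case/orP: vU; [left|right].
exists (T0 `\ t)%fset; split.
- exact: fsubset_trans (fsubD1set _ _) T0T.
- by move: leT0; rewrite cardfsU1 sS (cardfsD1 t T0) tT0 /= addnCA addnA.
rewrite eqEsubset; split.
  apply: Span_subset => v /=; rewrite !inE => /orP[|/andP[_ vT]].
    by move=> vS; apply: ST; rewrite /= !inE.
  by apply: mem_Span; exact: (fsubsetP T0T).
rewrite -T0E; apply: Span_subset => v /=; rewrite inE => /orP[vS|vT].
  by apply: mem_Span; rewrite /= !inE vS orbT.
(* Only [t] was dropped from the generators, and [tE] recovers it. *)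
have [->|vt] := eqVneq v t; last first.
  by apply: mem_Span; rewrite /= !inE vt vT !orbT.
apply: Span_subset tE => w [->|[/= wS|/=]]; rewrite ?inE => *; apply: mem_Span.
- by rewrite /= !inE eqxx.
- by rewrite /= !inE wS orbT.
- by rewrite /= !inE; apply/orP; right.
Qed.

End Span.

Theorem lemma3p8 (F : scalarGroupType) (V : nearVectType F) (S T : {fset V})
    (SQ : [set` S] `<=` quasi_kernel (V := V))
    (TQ : [set` T] `<=` quasi_kernel (V := V))
    (Sfree : lin_indep [set` S])
    (ST : Span [set` S] `<=` Span [set` T]) :
  (#|` S| <= #|` T|)%N /\
  exists T0 : {fset V},
    [/\ (T0 `<=` T)%fset, [disjoint T0 & S]%fset &
        Span [set` (S `|` T0)%fset] = Span [set` T]].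
Proof.
have [T0 [T0T leT0 T0E]] := Steinitz_exchange SQ TQ Sfree
  (subset_trans (@mem_Span _ _ _) ST).
split; first exact: leq_trans (leq_addr _ _) leT0.
(* Discarding [S] from [T0] gives disjointness and does not change the union with [S]. *)
exists (T0 `\` S)%fset; split.
- exact: fsubset_trans (fsubsetDl _ _) T0T.
- by apply/fdisjointP => v; rewrite inE => /andP[].
- by rewrite fsetUDl fsetDv fsetD0.
Qed.
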